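(* For every even integer $\ell\ge 2$ there exists an arithmetic $(3\ell^2+1,3,\ell,1)$-CEDF in $\mathbb{Z}_{3\ell^2+1}$.
   Context: For subsets $A,B$ of an additive group $G$, $\Delta(A,B)$ denotes the multiset $\{a-b\mid a\in A,\ b\in B\}$. Let $G$ be an additive group of order $v$. A sequence $(A_0,\dots,A_{m-1})$ of $m\ge 2$ pairwise disjoint $\ell$-subsets of $G$ is a $(v,m,\ell,\lambda)$-CEDF (circular external difference family) over $G$ if the multiset union $\bigcup_{i\in\mathbb{Z}_m}\Delta(A_{i+1},A_i)$ (indices modulo $m$) equals $\lambda(G\setminus\{0\})$, i.e. contains each nonzero element of $G$ exactly $\lambda$ times and does not contain $0$. An arithmetic progression of size $\ell\ge2$ in $G$ is a subset of $G$ with exactly $\ell$ elements of the form $\{id+a\mid i=1,\dots,\ell\}$ with $d,a\in G$, $d\ne 0$. A CEDF is called arithmetic if each of its sets $A_i$ is an arithmetic progression of size $\ell$ in $G$. *)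

(* Defs.v *)
From mathcomp Require Import all_boot all_algebra.

Set Implicit Arguments.
Unset Strict Implicit.
Unset Printing Implicit Defensive.

Import GRing.Theory.
Local Open Scope ring_scope.

Section CEDF.
Variable G : finZmodType.
Implicit Types (A B P : {set G}) (v m l lambda : nat).

(* Multisets over G are represented by sequences, through their
   multiplicity function [count_mem]; multiset union is concatenation. *)
Definition Delta A B : seq G := [seq a - b | a <- enum A, b <- enum B].

(* [ordS] is the cyclic successor i |-> i + 1 mod m on 'I_m. *)
Definition cyclic_differences m (A : 'I_m -> {set G}) : seq G :=
  flatten [seq Delta (A (ordS i)) (A i) | i <- enum 'I_m].

Definition is_CEDF v m l lambda (A : 'I_m -> {set G}) : Prop :=
  [/\ #|G| = v, (2 <= m)%N,
      (forall i, #|A i| = l),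
      (forall i j, i != j -> [disjoint A i & A j])
    & forall g : G,
        count_mem g (cyclic_differences A) = if g == 0 then 0%N else lambda].

Arguments is_CEDF : clear implicits.

(* The index i : 'I_l runs over 0, ..., l - 1, so i.+1 runs over 1, ..., l. *)
Definition is_arith_prog l P : Prop :=
  [/\ (2 <= l)%N, #|P| = l
    & exists d a : G, d != 0 /\ P = [set d *+ i.+1 + a | i : 'I_l]].

Definition is_arithmetic_CEDF v m l lambda (A : 'I_m -> {set G}) : Prop :=
  is_CEDF v m l lambda A /\ forall i, is_arith_prog l (A i).

End CEDF.

Arguments is_CEDF {G} v m l lambda A.
Arguments is_arithmetic_CEDF {G} v m l lambda A.

(* Main.v *)
Require Import Defs.
From mathcomp Require Import all_boot all_algebra.
From mathcomp Require Import zify ring.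

(** Write v = 3 l^2 + 1. Since l is even, Z_v is the quotient of the Eisenstein
    integers Z[w], w^2 + w + 1 = 0, by the element 1 - l (1 + 2 w), whose norm
    is v (1 + 2 w is a square root of -3); for l odd this element is divisible
    by 2 and the quotient is not cyclic. The three progressions have the three
    cube roots of unity as steps,
    A_i = w^i {1, ..., l} - (1 + w + ... + w^i),
    and the offsets are chosen so that A_{i+1} - A_i is the image under w^i of
    the rhombus {w x - y | 0 <= x < l, 1 <= y <= l}. The multiset of differences
    is thus a pinwheel of three rhombi around 0, which are rotated by 120
    degrees from each other; together with 0 it has v lattice points, and the
    theorem says that it is a fundamental domain of the quotient.

    It suffices to show that the pinwheel and 0 meet every class, because there
    are only 3 l^2 differences for the v - 1 nonzero elements
    ([tight_cyclic_differences]). This same count gives that the A_i have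
    exactly l elements, and that 0 is not a difference, hence that consecutive
    A_i, which for three sets means any two of them, are disjoint. To see that
    every class is met it is enough that the set of classes met contains 0 and
    is stable under adding 1 ([pinwheel_succ]), as 1 generates Z_v. Adding 1
    usually moves a point inside its rhombus, and the points that leave through
    an edge come back, modulo 1 - l (1 + 2 w), through an edge of another one. *)

Set Implicit Arguments.
Unset Strict Implicit.
Unset Printing Implicit Defensive.

Import GRing.Theory.
Local Open Scope ring_scope.

Lemma mem_cyclic_differences (G : finZmodType) m (A : 'I_m -> {set G}) i a b :
  a \in A (ordS i) -> b \in A i -> a - b \in cyclic_differences A.
Proof.
move=> aA bA; apply/flattenP; exists (Delta (A (ordS i)) (A i)).
  by apply: map_f; rewrite mem_enum.
by apply: (allpairs_f (fun a b => a - b)); rewrite mem_enum.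
Qed.

Lemma size_cyclic_differences (G : finZmodType) m (A : 'I_m -> {set G}) :
  size (cyclic_differences A) = (\sum_i #|A (ordS i)| * #|A i|)%N.
Proof.
rewrite size_flatten /shape -map_comp sumnE big_map big_enum /=.
by apply: eq_bigr => i _; rewrite /= size_allpairs -!cardE.
Qed.

(** There are at most m * l ^ 2 differences, which is the number of nonzero
    elements; so if all of these are differences, none is repeated, 0 is not
    one, and no set can have fewer than l elements. *)
Lemma tight_cyclic_differences (G : finZmodType) m l (A : 'I_m -> {set G}) :
    #|G| = (m * l ^ 2 + 1)%N -> (forall i, #|A i| <= l)%N ->
    (forall g, g != 0 -> g \in cyclic_differences A) ->
  (forall i, #|A i| = l) /\
  forall g, count_mem g (cyclic_differences A) = if g == 0 then 0%N else 1%N.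
Proof.
move=> cardG leAl cover; set s := cyclic_differences A.
have le_block i : (#|A (ordS i)| * #|A i| <= l ^ 2)%N.
  by rewrite -mulnn leq_mul.
have sum_l : (\sum_(i < m) l ^ 2 = m * l ^ 2)%N by rewrite sum_nat_const card_ord.
have size_nz : size (enum (predC1 (0 : G))) = (m * l ^ 2)%N.
  by rewrite -cardE cardC1 cardG addn1.
have sub_nz : {subset enum (predC1 (0 : G)) <= s}.
  by move=> g; rewrite mem_enum => /cover.
have le_size : (size s <= size (enum (predC1 (0%R : G))))%N.
  by rewrite size_nz size_cyclic_differences -sum_l leq_sum.
have [eq_size eq_mem] := uniq_min_size (enum_uniq _) sub_nz le_size.
have uniq_s := leq_size_uniq (enum_uniq _) sub_nz le_size.
split=> [i|g]; last first.
  by rewrite count_uniq_mem // -eq_mem mem_enum inE; case: eqP.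
(* The sum of the block sizes reaches its bound, hence so does each block. *)
have [_] := leqif_sum (fun i (_ : true) => leqif_eq (le_block i)).
rewrite -size_cyclic_differences sum_l -eq_size size_nz eqxx.
move=> /esym/forallP/(_ i)/= /eqP full_block; apply/eqP.
rewrite eqn_leq leAl leqNgt; apply/negP => lt_i.
suff: (#|A (ordS i)| * #|A i| < l ^ 2)%N by rewrite full_block ltnn.
have l_gt0 : (0 < l)%N by exact: leq_ltn_trans lt_i.
by rewrite -mulnn (leq_ltn_trans (leq_mul (leAl _) (leqnn _))) // ltn_pmul2l.
Qed.

Section Pinwheel.
Variables (R : comNzRingType) (w : R) (l : nat).
Hypotheses (w2 : w ^+ 2 + w + 1 = 0) (lw : l%:R * (2 * w + 1) = 1).

(** The coordinates are integers rather than naturals so that the subtractions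
    in [pinwheel_succ] are not truncated. *)
Definition rhombus i (g : R) := exists x y : int,
  [/\ 0 <= x < l%:Z, 1 <= y <= l%:Z & g = w ^+ i * (w * x%:~R - y%:~R)].

Definition pinwheel g := g = 0 \/ exists2 i, (i < 3)%N & rhombus i g.

(** In the rhombi 0, 1 and 2 adding 1 amounts to y - 1, to (x - 1, y + 1) and
    to x + 1 respectively. A point that this takes out of its rhombus is 0, or
    lands on an edge of another rhombus after subtracting a multiple of the
    relation [lw]. *)
Lemma pinwheel_succ g : (0 < l)%N -> pinwheel g -> pinwheel (g + 1).
Proof.
move=> l_gt0.
have hit i x y (h : R) : (i < 3)%N -> 0 <= x < l%:Z -> 1 <= y <= l%:Z ->
  h = w ^+ i * (w * x%:~R - y%:~R) -> pinwheel h.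
  by move=> *; right; exists i => //; exists x, y.
(* [a] and [b] are the cofactors which certify that h - h' lies in the ideal
   generated by the relations [w2] and [lw]. *)
have modw a b (h h' : R) :
  h - h' = a * (w ^+ 2 + w + 1) + b * (l%:R * (2 * w + 1) - 1) -> h = h'.
  by move=> E; apply/eqP; rewrite -subr_eq0 E w2 lw subrr !mulr0 addr0.
case=> [->|[[|[|[|//]]] _ [x [y [xl yl ->]]]]].
- apply: (hit 0%N (l%:Z - 1) l%:Z) => //; try lia.
  apply: (modw (2 * l%:R) (- 1 - w)); ring.
- case: (y =P 1) => [y1|y1]; last first.
    apply: (hit 0%N x (y - 1)) => //; try lia; ring.
  case: (x =P 0) => [->|x0]; first by left; rewrite y1; ring.
  apply: (hit 1%N (l%:Z - 1) (l%:Z + 1 - x)) => //; try lia.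
  rewrite y1; apply: (modw (1 - l%:R) 1); ring.
- case: (y =P l%:Z) => [yE|yl'].
    apply: (hit 2%N 0 (l%:Z - x)) => //; try lia.
    rewrite yE; apply: (modw l%:R (-1)); ring.
  case: (x =P 0) => [x0|x0]; last first.
    apply: (hit 1%N (x - 1) (y + 1)) => //; try lia; apply: (modw 1 0); ring.
  apply: (hit 0%N (l%:Z - 1 - y) l%:Z) => //; try lia.
  rewrite x0; apply: (modw (2 * l%:R) (- 1 - w)); ring.
- case: (x =P l%:Z - 1) => [xE|xl'].
    apply: (hit 1%N (l%:Z - y) 1) => //; try lia.
    rewrite xE; apply: (modw ((l%:R - 1) * (w - 1) + l%:R) (- w)); ring.
  apply: (hit 2%N (x + 1) y) => //; try lia; apply: (modw (1 - w) 0); ring.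
Qed.

Lemma pinwheel_nat n : (0 < l)%N -> pinwheel n%:R.
Proof.
by move=> l_gt0; elim: n => [|n IH]; [left | rewrite -natr1; exact: pinwheel_succ].
Qed.

End Pinwheel.

Section Arms.
Variables (R : finComNzRingType) (w : R) (l : nat).
Hypotheses (w2 : w ^+ 2 + w + 1 = 0) (lw : l%:R * (2 * w + 1) = 1).

Definition arm (i : 'I_3) : {set R} :=
  [set w ^+ i *+ (k : 'I_l).+1 - \sum_(j < i.+1) w ^+ j | k : 'I_l].

Lemma mem_arm (i : 'I_3) (x : int) : 1 <= x <= l%:Z ->
  w ^+ i * x%:~R - \sum_(j < i.+1) w ^+ j \in arm i.
Proof.
case: x => [[|k]|//] // /andP[_ lt_kl]; apply/imsetP.
by exists (Ordinal (lt_kl : (k < l)%N)); rewrite //= -mulr_natr.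
Qed.

Lemma card_arm i : (#|arm i| <= l)%N.
Proof. by rewrite (leq_trans (leq_imset_card _ _)) ?card_ord. Qed.

(** Consecutive offsets differ by - w ^+ i.+1, which turns the range 1, ..., l
    of the coordinate along w ^+ i.+1 into the range 0, ..., l - 1 of x; this
    holds also from the last arm to the first, since 1 + w + w ^+ 2 = 0. *)
Lemma rhombus_arms (i : 'I_3) g : rhombus w l i g -> g \in cyclic_differences arm.
Proof.
case=> x [y [x_bd y_bd ->]].
have x1_bd : 1 <= x + 1 <= l%:Z by lia.
suff -> : w ^+ i * (w * x%:~R - y%:~R) =
    (w ^+ ordS i * (x + 1)%:~R - \sum_(j < (ordS i).+1) w ^+ j) -
    (w ^+ i * y%:~R - \sum_(j < i.+1) w ^+ j).
  exact: mem_cyclic_differences (mem_arm (ordS i) x1_bd) (mem_arm i y_bd).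
case: i => [[|[|[|//]]] lt_i3]; rewrite !big_ord_recl !big_ord0 /= ?/bump /=.
- ring.
- ring.
- transitivity (x%:~R - w ^+ 2 * y%:~R
      + (w - 1) * x%:~R * (w ^+ 2 + w + 1)); first ring.
  transitivity (x%:~R - w ^+ 2 * y%:~R + (w ^+ 2 + w + 1)); last by ring.
  by rewrite w2 mulr0.
Qed.

Hypotheses (cardR : #|R| = (3 * l ^ 2 + 1)%N)
           (gen1 : forall g : R, exists n, g = n%:R).

Lemma arms_cover g : (0 < l)%N -> g != 0 -> g \in cyclic_differences arm.
Proof.
move=> l_gt0; have [n ->] := gen1 g.
case: (pinwheel_nat w2 lw n l_gt0) => [->|[i lt_i3 gi] _]; first by rewrite eqxx.
exact: (@rhombus_arms (Ordinal lt_i3)).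
Qed.

Lemma arms_CEDF : (2 <= l)%N -> is_arithmetic_CEDF (3 * l ^ 2 + 1) 3 l 1 arm.
Proof.
move=> l_ge2; have l_gt0 : (0 < l)%N by exact: ltnW.
have [card_eq count_eq] :=
  tight_cyclic_differences cardR card_arm (fun g => @arms_cover g l_gt0).
(* A common element would make 0 a difference. *)
have disj i : [disjoint arm (ordS i) & arm i].
  apply/pred0Pn => -[a /andP[a1 a2]].
  have := mem_cyclic_differences a1 a2.
  by rewrite subrr -has_pred1 has_count count_eq eqxx.
split=> [|i].
  split=> // i j ne_ij.
  have : (j == ordS i) || (i == ordS j).
    by move: i j ne_ij => [[|[|[|//]]] ?] [[|[|[|//]]] ?].
  by case/orP=> /eqP-> //; rewrite disjoint_sym.
split=> //; exists (w ^+ i), (- \sum_(j < i.+1) w ^+ j); split=> //.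
have w3 : w ^+ i * w ^+ (3 - i) = 1.
  rewrite -exprD subnKC; last exact: ltnW.
  by transitivity ((w - 1) * (w ^+ 2 + w + 1) + 1); [ring | rewrite w2; ring].
by apply/eqP => wi0; have := oner_neq0 R; rewrite -w3 wi0 mul0r eqxx.
Qed.

End Arms.

Local Close Scope ring_scope.

Theorem theorem4p1 (l : nat) (l_ge2 : 2 <= l) (l_even : ~~ odd l) :
  exists A : 'I_3 -> {set 'Z_(3 * l ^ 2 + 1)},
    is_arithmetic_CEDF (3 * l ^ 2 + 1) 3 l 1 A.
Proof.
have v_gt1 : (1 < 3 * l ^ 2 + 1)%N by nia.
have [k lk] : exists k, l = (2 * k)%N by exists l./2; lia.
set v := (3 * l ^ 2 + 1)%N in v_gt1 *.
(* As l * (- 3 * l) = 1 in 'Z_v, the relation l * (2 * w + 1) = 1 forces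
   2 * w = - 1 - 3 * l; adding v makes the right-hand side even, and half of
   it is w = (3 * l ^ 2 - 3 * l) / 2. *)
pose K : 'Z_v := k%:R%R; pose w : 'Z_v := (3 * K * (2 * K - 1))%R.
have v0 : (12 * K ^+ 2 + 1 = 0)%R.
  have vE : v = (12 * k ^ 2 + 1)%N by rewrite /v lk; lia.
  have := congr1 (fun n => n%:R%R : 'Z_v) vE.
  by rewrite pchar_Zp // /K => ->; ring.
have lK : (l%:R = 2 * K :> 'Z_v)%R by rewrite lk natrM.
exists (arm w l); apply: arms_CEDF => //.
- transitivity ((3 * K ^+ 2 - 3 * K + 1) * (12 * K ^+ 2 + 1))%R.
    by rewrite /w; ring.
  by rewrite v0 mulr0.
- transitivity ((2 * K - 1) * (12 * K ^+ 2 + 1) + 1)%R; first by rewrite lK /w; ring.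
  by rewrite v0 mulr0 add0r.
- by rewrite card_ord Zp_cast.
- by move=> g; exists g; rewrite natr_Zp.
Qed.
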